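(* Let $k\ge 1$ and let $f:\mathbb{N}^k\to\mathbb{C}$ with $f(\mathbf{1})\neq 0$, where $\mathbf{1}=(1,\ldots,1)$. Suppose there exist constants $C>0$ and $r_1,\ldots,r_k\in\mathbb{R}$ such that $|f(\mathbf{n})|\le C\,n_1^{r_1}\cdots n_k^{r_k}$ for all $\mathbf{n}=(n_1,\ldots,n_k)\in\mathbb{N}^k$ with $\mathbf{n}\neq\mathbf{1}$. Let $\alpha_1,\ldots,\alpha_k$ be real numbers with $\alpha_j>1+r_j$ $(j=1,\ldots,k)$ and $$\zeta(\alpha_1-r_1)\zeta(\alpha_2-r_2)\cdots\zeta(\alpha_k-r_k)\le 1+\frac{|f(\mathbf{1})|}{C},$$ where $\zeta$ is the Riemann zeta function. Then $F(s_1,\ldots,s_k;f)$ and $F(s_1,\ldots,s_k;f^{-1})$ have no zeros in the region $$\{(s_1,\ldots,s_k)\in\mathbb{C}^k : \Re(s_j)>1+\alpha_j\ (j=1,\ldots,k)\},$$ and in this region $$\bigl(F(s_1,\ldots,s_k;f)\bigr)^{-1}=F(s_1,\ldots,s_k;f^{-1}).$$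
   Context: For $g:\mathbb{N}^k\to\mathbb{C}$, the multiple Dirichlet series is $F(s_1,\ldots,s_k;g):=\sum_{m_1,\ldots,m_k=1}^\infty \frac{g(m_1,\ldots,m_k)}{m_1^{s_1}\cdots m_k^{s_k}}$, considered where it converges absolutely. For $\mathbf{a},\mathbf{b}\in\mathbb{N}^k$, $\mathbf{a}\cdot\mathbf{b}:=(a_1b_1,\ldots,a_kb_k)$. The multiple Dirichlet product of $f,g:\mathbb{N}^k\to\mathbb{C}$ is $(f*g)(\mathbf{n})=\sum_{\mathbf{a}\cdot\mathbf{b}=\mathbf{n},\ \mathbf{a},\mathbf{b}\in\mathbb{N}^k} f(\mathbf{a})g(\mathbf{b})$. The identity $I$ is $I(\mathbf{1})=1$, $I(\mathbf{n})=0$ otherwise. For $f$ with $f(\mathbf{1})\ne0$, $f^{-1}$ denotes the unique function with $f*f^{-1}=I$. *)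

(* Defs.v *)
From HB Require Import structures.
From mathcomp Require Import all_boot all_order all_algebra.
From mathcomp Require Import complex.
From mathcomp Require Import all_classical all_reals all_analysis.
From mathcomp Require summability.
Set Implicit Arguments.
Unset Strict Implicit.
Unset Printing Implicit Defensive.
Import Order.TTheory GRing.Theory Num.Theory numFieldNormedType.Exports.
Local Open Scope classical_set_scope.
Local Open Scope ring_scope.
Local Open Scope complex_scope.

Notation posnat := {n : nat | (0 < n)%N}.
Notation multi_posnat k := {ffun 'I_k -> posnat}.

Definition posnat_one : posnat := exist _ 1%N isT.

Lemma posnat_mul_subproof (a b : posnat) : (0 < val a * val b)%N.
Proof. by rewrite muln_gt0 (valP a) (valP b). Qed.

Definition posnat_mul (a b : posnat) : posnat :=
  exist _ (val a * val b)%N (posnat_mul_subproof a b).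

Definition mone {k : nat} : multi_posnat k := [ffun=> posnat_one].

Definition mmul {k : nat} (a b : multi_posnat k) : multi_posnat k :=
  [ffun j => posnat_mul (a j) (b j)].

(* The index set is finite (lemma [factorizations_finite]), so the \sum over a
   classical set below is a genuine finite sum. *)
Definition factorizations {k : nat} (n : multi_posnat k) :
    set (multi_posnat k * multi_posnat k) :=
  [set p | mmul p.1 p.2 = n].

Section dirichlet_product.
Context {R : realType} {k : nat}.
Implicit Types f g : multi_posnat k -> R[i].

Definition dirichlet_mul f g : multi_posnat k -> R[i] :=
  fun n => \sum_(p \in factorizations n) f p.1 * g p.2.

Definition dirichlet_id : multi_posnat k -> R[i] := fun n => (n == mone)%:R.

(* The chosen function is the unique inverse as soon as [f mone != 0], see
   lemmas [dirichlet_mulfV] and [dirichlet_inv_unique]; otherwise the value is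
   the default 0. *)
Definition dirichlet_inv f : multi_posnat k -> R[i] :=
  xget (fun=> 0) [set g | dirichlet_mul f g = dirichlet_id].

Lemma mmulE (a b : multi_posnat k) j :
  val (mmul a b j) = (val (a j) * val (b j))%N.
Proof. by rewrite ffunE. Qed.

Lemma mmul1m (a : multi_posnat k) : mmul mone a = a.
Proof. by apply/ffunP => j; apply: val_inj; rewrite mmulE ffunE mul1n. Qed.

Lemma factorizations_finite (n : multi_posnat k) : finite_set (factorizations n).
Proof.
pose B := (\max_(j < k) val (n j)).+1.
pose h (u : {ffun 'I_k -> 'I_B}) : multi_posnat k :=
  [ffun j => insubd posnat_one (u j : nat)].
pose H (u : {ffun 'I_k -> 'I_B} * {ffun 'I_k -> 'I_B}) := (h u.1, h u.2).
have hP (a : multi_posnat k) : (forall j, (val (a j) <= val (n j))%N) ->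
    exists u, h u = a.
  move=> lean; exists [ffun j => inord (val (a j))].
  apply/ffunP => j; rewrite !ffunE inordK; first by rewrite valKd.
  by rewrite ltnS (leq_trans (lean j))// (leq_bigmax (F := fun j => val (n j))).
apply: (@sub_finite_set _ _ (H @` [set: _])); last exact/finite_image/finite_finset.
move=> [a b] /= nE.
have [|u ua] := hP a.
  by move=> j; rewrite -nE mmulE leq_pmulr// (valP (b j)).
have [|v vb] := hP b.
  by move=> j; rewrite -nE mmulE leq_pmull// (valP (a j)).
by exists (u, v) => //; rewrite /H /= ua vb.
Qed.

Let size_of (n : multi_posnat k) := (\prod_(j < k) val (n j))%N.

Let size_of_gt0 n : (0 < size_of n)%N.
Proof. by apply: prodn_gt0 => j; exact: valP (n j). Qed.

Let size_of_lt (a b : multi_posnat k) :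
  a != mone -> (size_of b < size_of (mmul a b))%N.
Proof.
move=> a1; have -> : size_of (mmul a b) = (size_of a * size_of b)%N.
  by rewrite /size_of -big_split; apply: eq_bigr => j _; rewrite mmulE.
rewrite ltn_Pmull// ltn_neqAle size_of_gt0 andbT; apply: contra_neq a1 => sa1.
apply/ffunP => j; apply: val_inj; rewrite ffunE /=.
have : (val (a j) %| size_of a)%N by rewrite /size_of (bigD1 j)//= dvdn_mulr.
by rewrite -sa1 dvdn1 => /eqP.
Qed.

Let proper_factorizations (n : multi_posnat k) :=
  factorizations n `\` [set (mone, n)].

Let proper_lt n p : proper_factorizations n p -> (size_of p.2 < size_of n)%N.
Proof.
case: p => a b [/= <- ne] /=; apply: size_of_lt; apply/eqP => a1.
by apply: ne => /=; rewrite a1 mmul1m.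
Qed.

Let dirichlet_mul_split f g n : dirichlet_mul f g n =
  f mone * g n + \sum_(p \in proper_factorizations n) f p.1 * g p.2.
Proof.
rewrite /dirichlet_mul (fsbigD1 (mone, n)) //.
  exact: factorizations_finite.
exact: mmul1m.
Qed.

Lemma dirichlet_inv_unique f g h : f mone != 0 ->
  dirichlet_mul f g = dirichlet_id -> dirichlet_mul f h = dirichlet_id -> g = h.
Proof.
move=> f1 fg fh; apply/funext => n.
have [N] := ubnP (size_of n); elim: N n => // N IH n; rewrite ltnS => nN.
have : dirichlet_mul f g n = dirichlet_mul f h n by rewrite fg fh.
rewrite !dirichlet_mul_split (eq_fsbigr (fun p => f p.1 * h p.2)); last first.
  by move=> p /set_mem /proper_lt pn; rewrite IH// (leq_trans pn).
by move=> /addIr /(mulfI f1).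
Qed.

Let inv_rec f := fix rec (N : nat) (n : multi_posnat k) : R[i] :=
  if N is N'.+1 then
    (dirichlet_id n -
       \sum_(p \in proper_factorizations n) f p.1 * rec N' p.2) / f mone
  else 0.

Lemma dirichlet_mulfV f : f mone != 0 ->
  dirichlet_mul f (dirichlet_inv f) = dirichlet_id.
Proof.
move=> f1; pose g n := inv_rec f (size_of n) n.
have gE N n : (size_of n <= N)%N -> inv_rec f N n = g n.
  elim/ltn_ind: N n => -[_ n|N IH n nN]; first by rewrite leqNgt size_of_gt0.
  rewrite /g; case nE : (size_of n) => [|M].
    by move: (size_of_gt0 n); rewrite nE.
  rewrite /=; congr ((_ - _) / _); apply: eq_fsbigr => p /set_mem /proper_lt pn.
  have MN : (M <= N)%N by rewrite -ltnS -nE.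
  by rewrite !IH// -ltnS; [rewrite -nE|rewrite (leq_trans pn)].
suff : exists g, dirichlet_mul f g = dirichlet_id.
  by case=> g0 fg0; rewrite /dirichlet_inv; case: xgetP => [_ _ //|/(_ g0)].
exists g; apply/funext => n; rewrite dirichlet_mul_split.
rewrite {1}/g; case nE : (size_of n) => [|M].
  by move: (size_of_gt0 n); rewrite nE.
rewrite /= mulrC divfK// (eq_fsbigr (fun p => f p.1 * g p.2)) ?subrK//.
by move=> p /set_mem /proper_lt; rewrite nE ltnS => /gE ->.
Qed.

End dirichlet_product.

Section dirichlet_series.
Context {R : realType}.

Definition cexp (z : R[i]) : R[i] :=
  (expR (complex.Re z))%:C * (cos (complex.Im z) +i* sin (complex.Im z)).

Definition cpow (m : posnat) (s : R[i]) : R[i] :=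
  cexp (s * (ln (val m)%:R)%:C).

Definition dirichlet_term {k : nat} (g : multi_posnat k -> R[i])
    (s : 'I_k -> R[i]) (m : multi_posnat k) : R[i] :=
  g m / \prod_(j < k) cpow (m j) (s j).

Definition dirichlet_abs_cvg {k : nat} (g : multi_posnat k -> R[i])
    (s : 'I_k -> R[i]) : Prop :=
  summable [set: multi_posnat k]
    (fun m => (Normc.normc (dirichlet_term g s m))%:E).

(* The multiple series is the limit of its partial sums along the directed
   family of finite sets of indices; it is meaningful when
   [dirichlet_abs_cvg g s] holds. *)
Definition dirichlet_series {k : nat} (g : multi_posnat k -> R[i])
    (s : 'I_k -> R[i]) : R[i] :=
  summability.sum (fun m => dirichlet_term g s m : R[i]^o).

(* Riemann's zeta function on the real half-line x > 1. *)
Definition zeta (x : R) : R := limn (series (fun n : nat => n.+1%:R `^ (- x))).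

End dirichlet_series.

(* Main.v *)
Require Import Defs.
From HB Require Import structures.
From mathcomp Require Import all_boot all_order all_algebra.
From mathcomp Require Import complex.
From mathcomp Require Import all_classical all_reals all_analysis.
From mathcomp Require summability.
From mathcomp Require Import finmap.
From mathcomp Require Import ring lra.
Set Implicit Arguments.
Unset Strict Implicit.
Unset Printing Implicit Defensive.
Import Order.TTheory GRing.Theory Num.Theory numFieldNormedType.Exports.
Import summability Normc.
Local Open Scope classical_set_scope.
Local Open Scope ring_scope.

(** Write [n^a] for [n_1^a_1 ... n_k^a_k] and let [g] be the Dirichlet inverse
    of [f]. Solving [f * g = I] for [g n] and inducting on [n] gives
    [|g n| <= n^alpha / |f 1|]: for [n <> 1] the induction step is
    [|f 1| |g n| <= (C / |f 1|) n^alpha S] with [S] the sum of [m^(r - alpha)]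
    over the divisors [m <> 1] of [n], and [1 + S] is at most the product of the
    [zeta (alpha_j - r_j)], so [S <= |f 1| / C] by hypothesis. Hence both
    series converge absolutely in the region, and summing the absolutely
    convergent double family [f a * g b / (a b)^s] along boxes [A * A] and along
    the fibres of [(a, b) |-> a b] shows that their product is [1]. *)

#[local] Existing Instance totally_filter.

(** * Unconditional convergence of complex families over finite index sets *)

Section unconditional_sums.
Variable R : realType.
Implicit Types I J : choiceType.

Lemma normc_ge0 (z : R[i]) : 0 <= normc z.
Proof. by case: z => a b; exact: sqrtr_ge0. Qed.

Lemma normc_sum_le I (s : seq I) (P : pred I) (F : I -> R[i]) :
  normc (\sum_(i <- s | P i) F i) <= \sum_(i <- s | P i) normc (F i).
Proof.
apply: (big_ind2 (fun (x : R[i]) (y : R) => normc x <= y)) => //.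
- by rewrite normc0.
- by move=> x1 x2 y1 y2 h1 h2; exact: le_trans (le_normcD _ _) (lerD h1 h2).
Qed.

Lemma normc_le_ReIm (z : R[i]) : normc z <= `|complex.Re z| + `|complex.Im z|.
Proof.
case: z => a b /=; have ab0 : 0 <= `|a| + `|b| by rewrite addr_ge0.
rewrite -(ger0_norm ab0) -sqrtr_sqr ler_sqrt ?sqr_ge0// sqrrD.
rewrite !real_normK ?num_real//; by rewrite lerD2r lerDl mulrn_wge0// mulr_ge0.
Qed.

Lemma ReIm_sum I (s : seq I) (x : I -> R[i]) :
  \sum_(i <- s) x i =
  ((\sum_(i <- s) complex.Re (x i)) +i* (\sum_(i <- s) complex.Im (x i)))%C.
Proof.
elim: s => [|i s IH]; first by rewrite !big_nil.
by rewrite !big_cons IH; case: (x i).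
Qed.

Lemma partial_sumE I (V : zmodType) (x : I -> V) (A : {fset I}) :
  partial_sum x A = \sum_(i <- A) x i.
Proof. by rewrite /partial_sum big_seq_fsetE. Qed.

Lemma ler_sum_fset_subset I (x : I -> R) (A B : {fset I}) :
  (forall i, 0 <= x i) -> (A `<=` B)%fset ->
  \sum_(i <- A) x i <= \sum_(i <- B) x i.
Proof.
move=> x0 AB; rewrite [leRHS](big_fsetID _ (mem A))/=.
rewrite (_ : [fset i | i in B & i \in A]%fset = A) ?lerDl ?sumr_ge0//.
apply/fsetP => i; rewrite !inE/= andbC; case: (boolP (i \in A)) => //= iA.
by rewrite (fsubsetP AB).
Qed.

(** With its converse [summable_bound], this trades extended-real summability for a uniform bound on
    finite sums, the form that the convergence arguments use. *)
Lemma summable_bounded I (x : I -> R[i]) :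
  (exists M, forall A : {fset I}, \sum_(i <- A) normc (x i) <= M) ->
  esum.summable [set: I] (fun i => (normc (x i))%:E).
Proof.
move=> [M xM]; rewrite /esum.summable.
apply: (@le_lt_trans _ _ M%:E); last exact: ltry.
apply: ge_ereal_sup => _ [X [finX _] <-].
rewrite fsbig_finite//= (eq_bigr (fun i => (normc (x i))%:E)); last first.
  by move=> i _; rewrite /= ger0_norm// normc_ge0.
by rewrite sumEFin lee_fin.
Qed.

Lemma cvg_partial_sum_ge0 I (x : I -> R) (M : R) :
  (forall i, 0 <= x i) -> (forall A : {fset I}, \sum_(i <- A) x i <= M) ->
  exists l : R, partial_sum x @ totally --> l.
Proof.
move=> x0 xM; pose S := [set \sum_(i <- A) x i | A in [set: {fset I}]].
have supS : has_sup S.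
  split; first by exists (\sum_(i <- fset0) x i); exists fset0.
  by exists M => _ [A _ <-].
(* With nonnegative terms, the sums grow with the index set, so the net converges to their
   supremum. *)
exists (reals.sup S); apply/cvgrPdist_le => e e0.
have [_ [A _ <-] SA] := sup_adherent e0 supS.
exists A => // B /= AB; rewrite partial_sumE.
have BS : \sum_(i <- B) x i <= reals.sup S.
  by apply: ub_le_sup => //; [exact: supS.2|exists B].
have := ler_sum_fset_subset x0 AB.
rewrite ger0_norm ?subr_ge0//; lra.
Qed.

(** Write [x] as [(|x| + x) - |x|]: both families are nonnegative, with finite sums at most [M + M]
    and [M]. *)
Lemma cvg_partial_sum_real I (x : I -> R) (M : R) :
  (forall A : {fset I}, \sum_(i <- A) `|x i| <= M) ->
  exists l : R, partial_sum x @ totally --> l.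
Proof.
move=> xM.
have [|A|l xl] := @cvg_partial_sum_ge0 I (fun i => `|x i| + x i) (M + M).
- by move=> i; have := ler_norm (- x i); rewrite normrN; lra.
- rewrite big_split/= lerD// (le_trans _ (xM A))// ler_sum// => i _.
  exact: ler_norm.
have [|l' xl'] := cvg_partial_sum_ge0 _ xM; first by move=> i.
exists (l - l'); rewrite (_ : partial_sum x =
    fun A => partial_sum (fun i => `|x i| + x i) A -
             partial_sum (fun i => `|x i|) A).
  exact: cvgB.
by apply/funext => A; rewrite !partial_sumE -sumrB; apply: eq_bigr => i _; ring.
Qed.

Lemma cvg_partial_sum_complex I (x : I -> R[i]) :
  (exists M, forall A : {fset I}, \sum_(i <- A) normc (x i) <= M) ->
  exists l : R[i]^o, partial_sum x @ totally --> l.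
Proof.
move=> [M xM].
have [|a xa] := @cvg_partial_sum_real I (fun i => complex.Re (x i)) M.
  move=> A; rewrite (le_trans _ (xM A))// ler_sum// => i _.
  case: (x i) => u v /=; rewrite -sqrtr_sqr ler_sqrt ?addr_ge0 ?sqr_ge0//.
  by rewrite lerDl sqr_ge0.
have [|b xb] := @cvg_partial_sum_real I (fun i => complex.Im (x i)) M.
  move=> A; rewrite (le_trans _ (xM A))// ler_sum// => i _.
  case: (x i) => u v /=; rewrite -sqrtr_sqr ler_sqrt ?addr_ge0 ?sqr_ge0//.
  by rewrite lerDr sqr_ge0.
exists (a +i* b)%C.

(* The norm on [R[i]^o] takes values in [R[i]], so epsilon is a complex number; its positivity
   forces a zero imaginary part, and the estimate descends to [R]. *)
apply/(@cvgrPdist_le R[i] R[i]^o) => -[e e'].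
rewrite ltcE => /andP[/= /eqP-> e0].
have e20 : 0 < e / 2 by rewrite divr_gt0.
move/cvgrPdist_le : xa => /(_ _ e20) xa.
move/cvgrPdist_le : xb => /(_ _ e20) xb.
near=> A.
rewrite -[leLHS]/((normc ((a +i* b)%C - partial_sum x A))%:C)%C.
rewrite -[leRHS]/(e%:C)%C lecR partial_sumE ReIm_sum.
rewrite (le_trans (normc_le_ReIm _))//.
by rewrite [leRHS]splitr lerD//= -partial_sumE; near: A.
Unshelve. all: by end_near. Qed.

Lemma summable_bound I (x : I -> R[i]) :
  esum.summable [set: I] (fun i => (normc (x i))%:E) ->
  exists M, forall A : {fset I}, \sum_(i <- A) normc (x i) <= M.
Proof.
rewrite summableE => /fineK xE.
exists (fine (\esum_(i in [set: I]) `|(normc (x i))%:E|%E)) => A.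
rewrite -lee_fin xE -sumEFin; apply: esum_ge; exists [set` A] => //.
rewrite fsbig_finite//= set_fsetK lee_sum// => i _.
by rewrite lee_fin ler_norm.
Qed.

(** Summing the fibre sums over [N] gives the partial sum of [u] over the preimage of [N]. Finite
    fibres make this preimage a finite set, so the grouped net is the original one composed with
    [P]. *)
Lemma cvg_partial_sum_fibers I J (h : J -> I) (u : J -> R[i]) (L : R[i]^o) :
  (forall i, finite_set (h @^-1` [set i])) ->
  partial_sum u @ totally --> L ->
  partial_sum (fun i => \sum_(p \in h @^-1` [set i]) u p) @ totally --> L.
Proof.
move=> hfin uL.
have Pfin (N : {fset I}) : finite_set (h @^-1` [set` N]).
  rewrite (_ : _ @^-1` _ = \bigcup_(i in [set` N]) h @^-1` [set i]).
    exact: bigcup_finite.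
  by apply/seteqP; split => [p hp|p [i iN /= ->//]]; exists (h p).
pose P (N : {fset I}) := fset_set (h @^-1` [set` N]).
rewrite (_ : partial_sum _ = partial_sum u \o P).
  apply: cvg_comp uL => S [A _ AS].
  (* The preimages are cofinal: once [N] contains the image of [A], its preimage contains [A]. *)
  exists (h @` A)%fset => // N /= AN; apply: AS => /=.
  apply/fsubsetP => p pA; rewrite in_fset_set// mem_set//=.
  by apply: (fsubsetP AN); apply/imfsetP; exists p.
apply/funext => N /=; rewrite !partial_sumE.
transitivity (\sum_(i <- N) \sum_(p <- P N | h p == i) u p).
  rewrite big_seq [RHS]big_seq; apply: eq_bigr => i iN.
  rewrite fsbig_finite// [RHS]big_fset_condE; apply: eq_fbigl => p.
  apply/idP/idP.
    rewrite in_fset_set// => /set_mem/= hp; apply/imfsetP; exists p => //=.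
    by rewrite !inE hp eqxx in_fset_set// mem_set//= hp.
  move=> /imfsetP[q /=]; rewrite !inE => /andP[_ /eqP hq] ->.
  by rewrite in_fset_set// mem_set.
rewrite (exchange_big_dep xpredT)//= big_seq [RHS]big_seq; apply: eq_bigr => p.
rewrite in_fset_set// => /set_mem /= hpN.
under eq_bigl do rewrite eq_sym.
by rewrite -big_filter filter_pred1_uniq ?big_seq1// fset_uniq.
Qed.

Lemma cvgM_complex T (F : set_system T) {FF : Filter F} (f g : T -> R[i]^o)
    (a b : R[i]^o) :
  f @ F --> a -> g @ F --> b ->
  (fun t => (f t : R[i]) * (g t : R[i]) : R[i]^o) @ F -->
  ((a : R[i]) * (b : R[i]) : R[i]^o).
Proof. move=> fa gb; exact: (@cvgM R[i] T F FF f g a b fa gb). Qed.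

(** Enclosing a finite set of pairs in a box bounds its absolute sum by [M * M'], so the double
    family has some sum [L]. Along the squares of [A] its partial sums factor and tend to [X * Y],
    which identifies [L]. *)
Lemma cauchy_product I (x y : I -> R[i]) (X Y : R[i]) :
  esum.summable [set: I] (fun i => (normc (x i))%:E) ->
  esum.summable [set: I] (fun i => (normc (y i))%:E) ->
  partial_sum x @ totally --> (X : R[i]^o) ->
  partial_sum y @ totally --> (Y : R[i]^o) ->
  partial_sum (fun p : I * I => x p.1 * y p.2) @ totally --> (X * Y : R[i]^o).
Proof.
move=> /summable_bound[M xM] /summable_bound[M' yM] xX yY.
pose u (p : I * I) := x p.1 * y p.2.
have boxE (V : pzSemiRingType) (a b : I -> V) (A B : {fset I}) :
    \sum_(p <- (A `*` B)%fset) a p.1 * b p.2 =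
    (\sum_(i <- A) a i) * \sum_(j <- B) b j.
  rewrite /fsetM big_imfset2/=; last by move=> [? ?] [? ?] _ _ /= [-> ->].
  by rewrite mulr_suml; apply: eq_bigr => i _; rewrite mulr_sumr.
have [|L uL] := @cvg_partial_sum_complex _ u.
  exists (M * M') => P.
  pose A := [fset p.1 | p in P]%fset; pose B := [fset p.2 | p in P]%fset.
  have PAB : (P `<=` A `*` B)%fset.
    apply/fsubsetP => p pP; rewrite in_fsetM.
    by apply/andP; split; apply/imfsetP; exists p.
  rewrite (le_trans (ler_sum_fset_subset _ PAB)) => [//|p|].
    exact: normc_ge0.
  under eq_bigr do rewrite normcM.
  rewrite (boxE _ (fun i => normc (x i)) (fun i => normc (y i))).
  by rewrite ler_pM// sumr_ge0// => i _; exact: normc_ge0.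
pose F (A : {fset I}) : R[i]^o := partial_sum x A * partial_sum y A.
have FXY : F @ totally --> (X * Y : R[i]^o) by exact: (cvgM_complex xX yY).
have FL : F @ totally --> L.
  rewrite (_ : F = partial_sum u \o (fun A => A `*` A)%fset).
    apply: cvg_comp uL => S [P _ PS].
    exists ([fset p.1 | p in P] `|` [fset p.2 | p in P])%fset => // A /=.
    rewrite fsubUset => /andP[/fsubsetP A1 /fsubsetP A2]; apply: PS => /=.
    apply/fsubsetP => p pP; rewrite in_fsetM.
    by apply/andP; split; [apply: A1|apply: A2]; apply/imfsetP; exists p.
  by apply/funext => A; rewrite /F /= !partial_sumE boxE.
by have -> := @cvg_unique _ (@norm_hausdorff R[i] R[i]^o) _ _ _ _ FXY FL.
Qed.

End unconditional_sums.

(** * Bounds by zeta values for finite sums of monomials *)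

Section zeta_bounds.
Variable R : realType.

Lemma zeta_partial_sum_bound (x : R) (N : nat) : 1 < x ->
  series (fun n : nat => n.+1%:R `^ (- x)) N <= (1 - 2 `^ (1 - x))^-1.
Proof.
move=> x1; set a := fun n : nat => _; set q := 2 `^ (1 - x).
have a0 n : 0 <= a n by exact: powR_ge0.
have q1 : 0 < 1 - q.
  rewrite subr_gt0 /q /powR pnatr_eq0/= expR_lt1.
  by rewrite pmulr_llt0 ?ln_gt0 ?ltr1n// subr_lt0.
have qE : q = 2 * 2 `^ (- x) by rewrite /q powRD ?powRr1//; apply/implyP.
(* Bounding the odd-indexed terms [n >= 3] by their even predecessors gives
   [S_(2N+1) <= 1 + q S_N] with [q < 1]. *)
have SE : series a N.*2.+1 <= 1 + q * series a N.
  elim: N => [|N IH].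
    by rewrite !seriesEord/= big_ord_recl !big_ord0 mulr0 !addr0 /a powR1.
  rewrite doubleS !seriesSr mulrDr.
  (* Since [a n] is the power of [n + 1], index [2N + 1] carries the even number [2(N + 1)]. *)
  have e1 : a N.*2.+1 = 2 `^ (- x) * a N.
    by rewrite /a -powRM// -natrM mul2n doubleS.
  have e2 : a N.*2.+2 <= a N.*2.+1.
    rewrite /a !powRN lef_pV2 ?posrE ?powR_gt0//.
    by rewrite ge0_ler_powR ?nnegrE ?ler0n ?ler_nat//; lra.
  have e3 : q * a N = a N.*2.+1 + a N.*2.+1 by rewrite qE e1; ring.
  rewrite seriesSr in IH; lra.
have SN : series a N <= series a N.*2.+1.
  by rewrite -addnn -addSn series_addn lerDl sumr_ge0.
rewrite -[leRHS]mul1r ler_pdivlMr//; lra.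
Qed.

(** The uniform bound makes the monotone partial sums converge, so the [limn] in [zeta] is a true
    limit and dominates each of them. *)
Lemma series_le_zeta (x : R) (N : nat) : 1 < x ->
  series (fun n : nat => n.+1%:R `^ (- x)) N <= zeta x.
Proof.
move=> x1; have a0 n : 0 <= n.+1%:R `^ (- x) :> R by exact: powR_ge0.
have nd := @nondecreasing_series R _ xpredT 0%N (fun n _ _ => a0 n).
apply: nondecreasing_cvgn_le => //.
apply: nondecreasing_is_cvgn => //.
by exists (1 - 2 `^ (1 - x))^-1 => _ [n _ <-]; exact: zeta_partial_sum_bound.
Qed.

Definition mono_weight {k} (a : 'I_k -> R) (n : multi_posnat k) : R :=
  \prod_(j < k) (val (n j))%:R `^ a j.

Variable k : nat.
Implicit Types (a b x : 'I_k -> R) (m n : multi_posnat k).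

Lemma mono_weight_gt0 a n : 0 < mono_weight a n.
Proof. by apply: prodr_gt0 => j _; rewrite powR_gt0// ltr0n (valP (n j)). Qed.

Lemma mono_weight_ge0 a n : 0 <= mono_weight a n.
Proof. exact/ltW/mono_weight_gt0. Qed.

Lemma mono_weight1 a : mono_weight a mone = 1.
Proof. by rewrite /mono_weight big1// => j _; rewrite ffunE /= powR1. Qed.

Lemma mono_weightM a m n :
  mono_weight a (mmul m n) = mono_weight a m * mono_weight a n.
Proof.
rewrite /mono_weight -big_split; apply: eq_bigr => j _.
by rewrite mmulE natrM powRM.
Qed.

Lemma mono_weightD a b n :
  mono_weight (fun j => a j + b j) n = mono_weight a n * mono_weight b n.
Proof.
rewrite /mono_weight -big_split; apply: eq_bigr => j _ /=; rewrite powRD//.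
by apply/implyP => _; rewrite pnatr_eq0 -lt0n (valP (n j)).
Qed.

(** A finite set of indices lies in a box, and the sum over a full box factors into one partial zeta
    sum per coordinate. *)
Lemma sum_mono_weight_le_zeta x (A : {fset multi_posnat k}) :
  (forall j, 1 < x j) ->
  \sum_(n <- A) mono_weight (fun j => - x j) n <= \prod_(j < k) zeta (x j).
Proof.
move=> x1; pose N := (\max_(n <- A) \max_(j < k) val (n j))%N.
(* Coordinates are shifted down by one to match the indexing of the zeta series; [g] is injective on
   [A]. *)
pose g n : {ffun 'I_k -> 'I_N.+1} := [ffun j => inord (val (n j)).-1].
have gE n j : n \in A -> (g n j).+1 = val (n j) :> nat.
  move=> nA; have n0 := valP (n j); rewrite ffunE inordK ?prednK//.
  apply/leqW; apply: leq_trans (leq_bigmax_seq n nA isT).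
  exact: (leq_bigmax (F := fun j => val (n j))).
pose G (u : {ffun 'I_k -> 'I_N.+1}) : R := \prod_(j < k) (u j).+1%:R `^ (- x j).
have G0 u : 0 <= G u by apply: prodr_ge0 => j _; exact: powR_ge0.
have gu : uniq (map g A).
  rewrite map_inj_in_uniq ?fset_uniq// => m n mA nA mn.
  by apply/ffunP => j; apply: val_inj; rewrite -!gE// mn.
apply: (@le_trans _ _ (\sum_u G u)).
  rewrite big_seq (eq_bigr (G \o g)); last first.
    by move=> n nA; apply: eq_bigr => j _; rewrite gE.
  rewrite -big_seq -(big_map g xpredT G) big_uniq//= big_mkcond/=.
  by apply: ler_sum => u _; case: ifP.
rewrite -(bigA_distr_bigA (fun j (i : 'I_N.+1) => i.+1%:R `^ (- x j))).
apply: ler_prod => j _; apply/andP; split.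
  by apply: sumr_ge0 => i _; exact: powR_ge0.
by have := series_le_zeta N.+1 (x1 j); rewrite seriesEord.
Qed.

End zeta_bounds.

(** * Dirichlet series and their products *)

Section dirichlet_terms.
Variable R : realType.
Implicit Types (z w : R[i]).

Lemma cexpD z w : cexp (z + w) = cexp z * cexp w.
Proof.
case: z => a b; case: w => c d; rewrite /cexp/= expRD cosD sinD.
apply/eqP; rewrite eq_complex/=; apply/andP; split; apply/eqP; ring.
Qed.

Lemma normc_cexp z : normc (cexp z) = expR (complex.Re z).
Proof.
rewrite /cexp normcM /= cos2Dsin2 sqrtr1 mulr1 expr0n/= addr0 sqrtr_sqr.
by rewrite ger0_norm// expR_ge0.
Qed.

Lemma normc_cpow (m : posnat) (s : R[i]) :
  normc (cpow m s) = (val m)%:R `^ complex.Re s.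
Proof.
rewrite /cpow normc_cexp /powR pnatr_eq0 eqn0Ngt (valP m)/=.
by case: s => a b /=; rewrite mulr0 subr0.
Qed.

Lemma cpowM (m n : posnat) (s : R[i]) :
  cpow (posnat_mul m n) s = cpow m s * cpow n s.
Proof.
rewrite /cpow -cexpD -mulrDr -rmorphD/= natrM lnM// posrE ltr0n.
  exact: (valP m).
exact: (valP n).
Qed.

Variable k : nat.
Implicit Types (f g : multi_posnat k -> R[i]) (s : 'I_k -> R[i]).
Implicit Types n : multi_posnat k.

Lemma normc_dirichlet_term g s n :
  normc (dirichlet_term g s n) =
  normc (g n) * mono_weight (fun j => - complex.Re (s j)) n.
Proof.
rewrite /dirichlet_term normcM normcV.
rewrite (big_morph _ (@normcM R) (@normc1 R)) -prodfV.
by congr (_ * _); apply: eq_bigr => j _; rewrite normc_cpow powRN.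
Qed.

(** Complete multiplicativity of [m^s] distributes the denominator over each factorization; this
    puts the product series in the form of fibre sums of [mmul]. *)
Lemma dirichlet_termM f g s n :
  dirichlet_term (dirichlet_mul f g) s n =
  \sum_(p \in factorizations n) dirichlet_term f s p.1 * dirichlet_term g s p.2.
Proof.
rewrite /dirichlet_term /dirichlet_mul mulr_fsuml.
apply: eq_fsbigr => -[a b] /set_mem /= <-.
rewrite mulf_div -big_split/=; congr (_ / _).
by apply: eq_bigr => j _; rewrite ffunE cpowM.
Qed.

Lemma dirichlet_term_id s n :
  dirichlet_term dirichlet_id s n = (n == mone)%:R.
Proof.
rewrite /dirichlet_term /dirichlet_id.
case: eqP => [->|_]; last by rewrite mul0r.
rewrite big1 ?divr1// => j _.
rewrite ffunE /cpow ln1 mulr0 /cexp/= expR0 cos0 sin0.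
by rewrite mul1r.
Qed.

(** Absolute convergence ensures that the limit defining [dirichlet_series] exists. *)
Lemma cvg_dirichlet_series g s : dirichlet_abs_cvg g s ->
  partial_sum (dirichlet_term g s) @ totally -->
  (dirichlet_series g s : R[i]^o).
Proof.
move=> /summable_bound/cvg_partial_sum_complex[l gl].
have -> : dirichlet_series g s = l.
  apply: (@cvg_lim R[i]^o); last exact: gl.
  exact: (@norm_hausdorff R[i] R[i]^o).
exact: gl.
Qed.

Lemma dirichlet_series_inverse f g s :
  dirichlet_mul f g = dirichlet_id ->
  dirichlet_abs_cvg f s -> dirichlet_abs_cvg g s ->
  dirichlet_series f s * dirichlet_series g s = 1.
Proof.
move=> fg fs gs.
have FG := cauchy_product fs gs
  (cvg_dirichlet_series fs) (cvg_dirichlet_series gs).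
pose h (p : multi_posnat k * multi_posnat k) := mmul p.1 p.2.
have FGl :=
  @cvg_partial_sum_fibers R _ _ h _ _ (@factorizations_finite k) FG.
have F1 : partial_sum (fun n => \sum_(p \in factorizations n)
    dirichlet_term f s p.1 * dirichlet_term g s p.2) @ totally --> (1 : R[i]^o).
  rewrite (_ : (fun n => _) = fun n => (n == mone)%:R).
    (* The partial sums equal 1 as soon as the index set contains [mone]. *)
    apply: (@cvg_near_cst _ R[i]^o 1).
    exists [fset mone]%fset => // A /= /fsubsetP A1.
    rewrite partial_sumE (big_fsetD1 mone)/= ?A1 ?inE// eqxx big1_seq ?addr0//.
    by move=> n /=; rewrite !inE => /andP[/negbTE ->].
  by apply/funext => n; rewrite -dirichlet_termM fg dirichlet_term_id.
exact: (@cvg_unique _ (@norm_hausdorff R[i] R[i]^o) _ _ _ _ FGl F1).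
Qed.

(** The terms are dominated by [M] times monomials with exponents [a j - Re (s j) < -1], whose
    finite sums are bounded by zeta values. *)
Lemma dirichlet_abs_cvg_weight g s (M : R) (a : 'I_k -> R) :
  (forall n, normc (g n) <= M * mono_weight a n) ->
  (forall j, 1 + a j < complex.Re (s j)) ->
  dirichlet_abs_cvg g s.
Proof.
move=> ga as1; apply: summable_bounded.
exists (M * \prod_(j < k) zeta (complex.Re (s j) - a j)) => A.
have M0 : 0 <= M.
  by have := le_trans (normc_ge0 _) (ga mone); rewrite mono_weight1 mulr1.
have x1 j : 1 < complex.Re (s j) - a j by have := as1 j; lra.
apply: (le_trans _ (ler_wpM2l M0 (sum_mono_weight_le_zeta A x1))).
rewrite mulr_sumr; apply: ler_sum => n _.
rewrite normc_dirichlet_term (_ : (fun j => - (_ - _)) =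
  fun j => a j + - complex.Re (s j)).
  by rewrite mono_weightD mulrA ler_wpM2r// mono_weight_ge0.
by apply/funext => j; ring.
Qed.

End dirichlet_terms.

(** * Growth of the Dirichlet inverse *)

Section inverse_bound.
Variables (R : realType) (k : nat).
Implicit Types (n m : multi_posnat k).

(** Induction measure: it drops strictly when a factor other than [mone] is removed. *)
Let size_of n := (\sum_(j < k) val (n j))%N.

Let size_of_lt m n : m != mone -> (size_of n < size_of (mmul m n))%N.
Proof.
move=> m1; have [j mj] : exists j, val (m j) != 1%N.
  apply/existsP; apply: contraNT m1; rewrite negb_exists => /forallP m1.
  apply/eqP/ffunP => j; apply: val_inj; rewrite ffunE; apply/eqP.
  by rewrite -[_ == _]negbK.
rewrite /size_of (bigD1 j)//= [ltnRHS](bigD1 j)//= -addSn leq_add//.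
  by rewrite mmulE ltn_Pmull ?(valP (n j))// ltn_neqAle eq_sym mj (valP (m j)).
by apply: leq_sum => i _; rewrite mmulE leq_pmull// (valP (m i)).
Qed.

Lemma mmul_eq1 m n : mmul m n = mone -> m = mone.
Proof.
move=> mn; apply/ffunP => j; apply: val_inj; have := mmulE m n j.
by rewrite mn ffunE /= => /esym/eqP; rewrite muln_eq1 => /andP[/eqP].
Qed.

Lemma mmulI m : injective (mmul m).
Proof.
move=> a b ab; apply/ffunP => j; apply: val_inj; apply/eqP.
by rewrite -(eqn_pmul2l (valP (m j))) -!mmulE ab.
Qed.

Variables (f g : multi_posnat k -> R[i]) (C : R) (r alpha : 'I_k -> R).
Hypothesis f1 : f mone != 0.
Hypothesis C0 : 0 < C.
Hypothesis fC : forall n, n != mone -> normc (f n) <= C * mono_weight r n.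
Hypothesis ralpha : forall j, 1 + r j < alpha j.
Hypothesis zeta_le :
  \prod_(j < k) zeta (alpha j - r j) <= 1 + normc (f mone) / C.
Hypothesis fg : dirichlet_mul f g = dirichlet_id.

(** These pairs index the terms of the convolution at [n] that involve [g] only at smaller
    arguments. *)
Let P n := (fset_set (factorizations n) `\ (mone, n))%fset.

Let PP n p : p \in P n -> [/\ mmul p.1 p.2 = n & p.1 != mone].
Proof.
rewrite !inE in_fset_set; last exact: factorizations_finite.
case: p => a b /andP[/= ne /set_mem/= ab]; split => //.
by apply: contra_neq ne => a1; rewrite -ab a1 mmul1m.
Qed.

Let f1_gt0 : 0 < normc (f mone).
Proof.
by rewrite lt_neqAle normc_ge0 andbT eq_sym; apply: contra_neq f1 => /eq0_normc.
Qed.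

Let weight_sum n :
  \sum_(p <- P n) mono_weight (fun j => - (alpha j - r j)) p.1 <=
  normc (f mone) / C.
Proof.
pose w m := mono_weight (fun j => - (alpha j - r j)) m.
pose D := [fset p.1 | p in P n]%fset.
(* The first factor determines the second by [mmulI], so no divisor is counted twice. *)
have -> : \sum_(p <- P n) w p.1 = \sum_(m <- D) w m.
  apply/esym; rewrite /D; move: (P n) (@PP n) => Q QP.
  rewrite big_imfset// => -[a b] [c d] /QP[/= ab _] /QP[/= cd _] /= ac.
  by move: ab; rewrite -cd ac => /mmulI ->.
have D1 : mone \notin D.
  by apply/imfsetP => -[p /= /PP[_ /[swap] <-]]; rewrite eqxx.
(* The added 1 is the weight of [mone], which completes [D] to a finite set to which the zeta bound
   applies. *)
rewrite -(lerD2l 1) (le_trans _ zeta_le)//.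
have -> : 1 + \sum_(m <- D) w m = \sum_(m <- (mone |` D)%fset) w m.
  by rewrite big_fsetU1//= /w mono_weight1.
by apply: sum_mono_weight_le_zeta => j; have := ralpha j; lra.
Qed.

Lemma dirichlet_inverse_bound n :
  normc (g n) <= (normc (f mone))^-1 * mono_weight alpha n.
Proof.
have [N] := ubnP (size_of n); elim: N n => // N IH n; rewrite ltnS => nN.
have fgn : f mone * g n + \sum_(p <- P n) f p.1 * g p.2 = (n == mone)%:R.
  rewrite -[RHS]/(dirichlet_id n) -fg /dirichlet_mul fsbig_finite.
    rewrite (big_fsetD1 (mone, n))//= in_fset_set; last first.
      exact: factorizations_finite.
    by rewrite mem_set//= /factorizations/= mmul1m.
  exact: factorizations_finite.
rewrite ler_pdivlMl// -normcM.
(* At [mone] no other factorization exists, so [f mone * g mone = 1] and the bound is an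
   equality. *)
have [n1|n1] := eqVneq n mone.
  move: fgn; rewrite big_seq big1 => [|p /PP[pn]]; last first.
    by rewrite n1 in pn; rewrite (mmul_eq1 pn) eqxx.
  by rewrite addr0 n1 eqxx => ->; rewrite normc1 mono_weight1.
move/eqP: fgn; rewrite (negbTE n1) addr_eq0 => /eqP ->; rewrite normcN.
rewrite (le_trans (normc_sum_le _ _ _))//.
pose w m := mono_weight (fun j => - (alpha j - r j)) m.
apply: (@le_trans _ _ (\sum_(p <- P n)
    C / normc (f mone) * mono_weight alpha n * w p.1)).
  rewrite big_seq [leRHS]big_seq; apply: ler_sum => p /PP[pn p1].
  have gp : normc (g p.2) <= (normc (f mone))^-1 * mono_weight alpha p.2.
    by apply: IH; rewrite (leq_trans _ nN)// -pn size_of_lt.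
  apply: (@le_trans _ _ (C * mono_weight r p.1 *
      ((normc (f mone))^-1 * mono_weight alpha p.2))).
    by rewrite normcM ler_pM ?normc_ge0 ?fC.
  rewrite -pn mono_weightM.
  (* Splitting [r] as [alpha + (r - alpha)] lets the [alpha] weights of both factors recombine into
     that of [n]. *)
  have -> : mono_weight r p.1 = mono_weight alpha p.1 * w p.1.
    by rewrite /w -mono_weightD; congr mono_weight; apply/funext => j; ring.
  by rewrite le_eqVlt; apply/orP; left; apply/eqP; ring.
rewrite -mulr_sumr.
have K0 : 0 <= C / normc (f mone) * mono_weight alpha n.
  by rewrite mulr_ge0 ?mono_weight_ge0// divr_ge0// ltW.
rewrite (le_trans (ler_wpM2l K0 (weight_sum n)))// le_eqVlt.
apply/orP; left; apply/eqP; by field; rewrite !gt_eqF.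
Qed.

End inverse_bound.

(** * Nonvanishing and inversion in the region *)

Theorem theorem3p5 (R : realType) (k : nat) (hk : (1 <= k)%N)
    (f : multi_posnat k -> complex R) (hf : f mone != 0)
    (C : R) (hC : 0 < C) (r : 'I_k -> R)
    (hbound : forall n : multi_posnat k, n != mone ->
       Normc.normc (f n) <= C * \prod_(j < k) (val (n j))%:R `^ r j)
    (alpha : 'I_k -> R) (halpha : forall j : 'I_k, 1 + r j < alpha j)
    (hzeta : \prod_(j < k) zeta (alpha j - r j)
               <= 1 + Normc.normc (f mone) / C)
    (s : 'I_k -> complex R)
    (hs : forall j : 'I_k, 1 + alpha j < complex.Re (s j)) :
  [/\ dirichlet_abs_cvg f s,
      dirichlet_abs_cvg (dirichlet_inv f) s,
      dirichlet_series f s != 0,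
      dirichlet_series (dirichlet_inv f) s != 0 &
      (dirichlet_series f s)^-1 = dirichlet_series (dirichlet_inv f) s].
Proof.
have fg := dirichlet_mulfV hf.
have fcvg : dirichlet_abs_cvg f s.
  (* Adding [normc (f mone)] to [C] extends the bound to [n = mone], which [hbound] leaves out. *)
  apply: (@dirichlet_abs_cvg_weight _ _ _ _ (C + normc (f mone)) r) => [n|j];
      last first.
    by have := halpha j; have := hs j; lra.
  have [->|n1] := eqVneq n mone; first by rewrite mono_weight1 mulr1 lerDr ltW.
  rewrite (le_trans (hbound n n1))// ler_wpM2r ?mono_weight_ge0//.
  by rewrite lerDl normc_ge0.
have gcvg : dirichlet_abs_cvg (dirichlet_inv f) s.
  have gle := dirichlet_inverse_bound hf hC hbound halpha hzeta fg.
  exact: dirichlet_abs_cvg_weight gle hs.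
have FG := dirichlet_series_inverse fg fcvg gcvg.
have F0 : dirichlet_series f s != 0.
  by apply/eqP => F0; move/eqP: FG; rewrite F0 mul0r eq_sym oner_eq0.
have G0 : dirichlet_series (dirichlet_inv f) s != 0.
  by apply/eqP => G0; move/eqP: FG; rewrite G0 mulr0 eq_sym oner_eq0.
by split => //; rewrite -[LHS]mulr1 -FG mulKf.
Qed.
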